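(* Let $m,n\ge 1$ and $k,d\ge 0$ be integers, let $\pi\in L([n])$ with $\mathrm{pk}(\pi)=k$ and $\mathrm{des}(\pi)=d$, and let $\sigma\in L([n]+m)$. Then: (i) If $\mathrm{type}(\pi)=(t_1,\dots,t_{2k})$, $\chi^+(\pi)=0$ and $\pi\notin\Pi^{(1)}_{n,k,d}$, then there exists $\pi'\in\Pi^{(1)}_{n,k,d}$ with $(\mathrm{udr},\mathrm{pk},\mathrm{des})(\pi)=(\mathrm{udr},\mathrm{pk},\mathrm{des})(\pi')$ and $(\mathrm{udr},\mathrm{pk},\mathrm{des})S(\pi,\sigma)=(\mathrm{udr},\mathrm{pk},\mathrm{des})S(\pi',\sigma)$. (ii) If $\mathrm{type}(\pi)=(t_1,\dots,t_{2k+1})$, $\chi^+(\pi)=0$ and $\pi\notin\Pi^{(2)}_{n,k,d}$, then the same conclusion holds with some $\pi'\in\Pi^{(2)}_{n,k,d}$. (iii) If $\mathrm{type}(\pi)=(t_1,\dots,t_{2k+1})$, $\chi^+(\pi)=1$ and $\pi\notin\Pi^{(3)}_{n,k,d}$, then the same conclusion holds with some $\pi'\in\Pi^{(3)}_{n,k,d}$. (iv) If $\mathrm{type}(\pi)=(t_1,\dots,t_{2k+2})$, $\chi^+(\pi)=1$ and $\pi\notin\Pi^{(4)}_{n,k,d}$, then the same conclusion holds with some $\pi'\in\Pi^{(4)}_{n,k,d}$.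
   Context: $[n]=\{1,\dots,n\}$, $[n]+m=\{n+1,\dots,n+m\}$. For a finite $U\subset\mathbb{P}$, $L(U)$ is the set of permutations (words) of $U$. For $\pi=\pi_1\cdots\pi_n$: $\mathrm{des}(\pi)$ is the number of $i\in[n-1]$ with $\pi_i>\pi_{i+1}$; $\mathrm{pk}(\pi)$ is the number of $i$ with $2\le i\le n-1$ and $\pi_{i-1}<\pi_i>\pi_{i+1}$. A birun of a word is a maximal factor of consecutive entries that is strictly increasing or strictly decreasing (consecutive biruns share their common endpoint; e.g. $6534792$ has biruns $653,3479,92$). $\mathrm{udr}(\pi)$ is the number of biruns of the word $0\pi_1\cdots\pi_n$. $\mathrm{type}(\pi)=(t_1,\dots,t_r)$ lists the lengths of the biruns of $\pi$ from left to right. $\chi^+(\pi)=1$ if $\pi_1>\pi_2$, else $0$. For disjoint $U,V$, $\pi\in L(U)$, $\sigma\in L(V)$, $S(\pi,\sigma)$ is the set of $\tau\in L(U\cup V)$ containing both $\pi$ and $\sigma$ as subsequences, and $(\mathrm{udr},\mathrm{pk},\mathrm{des})S(\pi,\sigma)$ denotes the multiset $\{(\mathrm{udr}(\tau),\mathrm{pk}(\tau),\mathrm{des}(\tau)):\tau\in S(\pi,\sigma)\}$. Define: $\Pi^{(1)}_{n,k,d}=\{\pi\in L([n]):\chi^+(\pi)=0,\ \mathrm{type}(\pi)=(t_1,\dots,t_{2k})\}$ with $t_1=n-d-k+1$, $t_2=d-k+2$, $t_i=2$ for $2<i\le 2k$; $\Pi^{(2)}_{n,k,d}=\{\pi\in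 L([n]):\chi^+(\pi)=0,\ \mathrm{type}(\pi)=(t_1,\dots,t_{2k+1})\}$ with $t_1=n-d-k$, $t_2=d-k+2$, $t_i=2$ for $2<i\le 2k+1$; $\Pi^{(3)}_{n,k,d}=\{\pi\in L([n]):\chi^+(\pi)=1,\ \mathrm{type}(\pi)=(t_1,\dots,t_{2k+1})\}$ with $t_1=d-k+1$, $t_2=n-d-k+1$, $t_i=2$ for $2<i\le 2k+1$; $\Pi^{(4)}_{n,k,d}=\{\pi\in L([n]):\chi^+(\pi)=1,\ \mathrm{type}(\pi)=(t_1,\dots,t_{2k+2})\}$ with $t_1=d-k+1$, $t_2=n-d-k$, $t_i=2$ for $2<i\le 2k+2$. *)

(* Defs.v *)
From mathcomp Require Import all_boot.

Set Implicit Arguments.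
Unset Strict Implicit.
Unset Printing Implicit Defensive.

(* A finite set U of positive integers is given by a duplicate-free sequence:
   [n] is iota 1 n, and [n]+m = {n+1, ..., n+m} is iota n.+1 m. *)
Definition L (U : seq nat) : pred (seq nat) := [pred w | perm_eq w U].

(* Positions are 0-based, so the i-th letter is nth 0 w i.-1. *)
Definition des (w : seq nat) : nat :=
  count (fun i => nth 0 w i > nth 0 w i.+1) (iota 0 (size w).-1).

Definition pk (w : seq nat) : nat :=
  count (fun i => (nth 0 w i.-1 < nth 0 w i) && (nth 0 w i > nth 0 w i.+1))
        (iota 1 (size w - 2)).

Definition monotone (w : seq nat) : bool := sorted ltn w || sorted gtn w.

(* The pair p = (i, j) stands for the factor at positions i, ..., j - 1. *)
Definition factor (w : seq nat) (p : nat * nat) : seq nat :=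
  take (p.2 - p.1) (drop p.1 w).

(* All pairs (i, j) with i < j <= size w, ordered by increasing i. *)
Definition positions (w : seq nat) : seq (nat * nat) :=
  [seq (i, j) | i <- iota 0 (size w), j <- iota i.+1 (size w - i)].

Definition is_birun (w : seq nat) (p : nat * nat) : bool :=
  monotone (factor w p) &&
  all (fun q => [&& q.1 <= p.1, p.2 <= q.2 & monotone (factor w q)] ==> (q == p))
      (positions w).

(* A one-letter word has exactly one birun, of length 1. *)
Definition biruns (w : seq nat) : seq (seq nat) :=
  [seq factor w p | p <- positions w & is_birun w p].

Definition udr (w : seq nat) : nat := size (biruns (0 :: w)).

Definition type (w : seq nat) : seq nat := [seq size b | b <- biruns w].

Definition chi_plus (w : seq nat) : nat :=
  if w is x :: y :: _ then x > y else 0.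

Definition shuffles (pi sigma : seq nat) : seq (seq nat) :=
  [seq tau <- permutations (pi ++ sigma) | subseq pi tau & subseq sigma tau].

Definition stat (w : seq nat) : nat * nat * nat := (udr w, pk w, des w).

(* The multiset of values on shuffles pi sigma, up to perm_eq. *)
Definition statS (pi sigma : seq nat) : seq (nat * nat * nat) :=
  [seq stat tau | tau <- shuffles pi sigma].

(* (t1, t2, 2, ..., 2) truncated to its first r terms. *)
Definition hook_type (r t1 t2 : nat) : seq nat := mkseq (nth 2 [:: t1; t2]) r.

(* Subtraction is truncated, but only when the integer value is negative; as
   birun lengths are positive, such a value is never a birun length, whether or
   not it is truncated to 0. *)
Definition Pi1 (n k d : nat) : pred (seq nat) :=
  [pred w | [&& w \in L (iota 1 n), chi_plus w == 0 &
     type w == hook_type (2 * k) (n + 1 - (d + k)) (d + 2 - k)]].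

Definition Pi2 (n k d : nat) : pred (seq nat) :=
  [pred w | [&& w \in L (iota 1 n), chi_plus w == 0 &
     type w == hook_type (2 * k + 1) (n - (d + k)) (d + 2 - k)]].

Definition Pi3 (n k d : nat) : pred (seq nat) :=
  [pred w | [&& w \in L (iota 1 n), chi_plus w == 1 &
     type w == hook_type (2 * k + 1) (d + 1 - k) (n + 1 - (d + k))]].

Definition Pi4 (n k d : nat) : pred (seq nat) :=
  [pred w | [&& w \in L (iota 1 n), chi_plus w == 1 &
     type w == hook_type (2 * k + 2) (d + 1 - k) (n - (d + k))]].

(* Main.v *)
Require Import Defs.
From mathcomp Require Import all_boot zify.

Set Implicit Arguments.
Unset Strict Implicit.
Unset Printing Implicit Defensive.

(** The statistics of a word w of positive letters are read off the up/down
pattern of 0w, a word s over {U, D} starting with U: the biruns are its maximal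
constant runs, des counts its letters D, and udr and pk amount to the number of
factors UD, the second letter and the last letter of s.

All letters of sigma exceed those of pi, so a shuffle is obtained by inserting
consecutive factors of sigma into the gaps of pi, and inserting a nonempty
factor f replaces the letter of s at that gap by U p(f) D, with p(f) the pattern
of f (in the gap after pi it appends U p(f)). A factor UD of s survives exactly
when neither of its letters is replaced. Cut s into tokens UD, U, D, where U and
D stand for the letters outside the factors UD. The statistics of a shuffle then
depend only on the factors inserted, in order, and on which letters of the
tokens are replaced, listed by kind of token. Two patterns with the same length
and statistics have equally many tokens of each kind, so these data can be
carried over from one to the other, and this gives a bijection between the
shuffles. It remains to note that a hook-shaped pattern with the same statistics
exists, and that every pattern is the pattern of a permutation. *)

(** * Patterns and biruns *)

(* [true] marks a descent. *)
Definition pattern (w : seq nat) : bitseq :=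
  if w is x :: w' then pairmap gtn x w' else [::].

(** The default [~~ b] makes the last letter open a run of its own. *)
Fixpoint runs (s : bitseq) : seq nat :=
  if s is b :: s' then
    if b == head (~~ b) s' then incr_nth (runs s') 0 else 1 :: runs s'
  else [::].

Lemma runs_cons b c s :
  runs (b :: c :: s) =
  if b == c then (head 0 (runs (c :: s))).+1 :: behead (runs (c :: s))
  else 1 :: runs (c :: s).
Proof.
rewrite [LHS]/= -/(runs (c :: s)); case: eqP => // _.
by case: (runs (c :: s)).
Qed.

Lemma runs_head_gt0 b s : 0 < head 0 (runs (b :: s)).
Proof. by case: s => [|c s]; [case: b | rewrite runs_cons; case: ifP]. Qed.

Lemma head_runs_leq s : head 0 (runs s) <= size s.
Proof.
elim: s => [|b [|c s] IHs] //; first by case: b.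
by rewrite runs_cons; case: ifP.
Qed.

Lemma monotone_behead x w : monotone (x :: w) -> monotone w.
Proof.
rewrite /monotone => /orP[] /= /path_sorted ->; first by [].
by rewrite orbT.
Qed.

Lemma monotone_take i j w : i <= j -> monotone (take j w) -> monotone (take i w).
Proof.
move=> le_ij; rewrite -[take i w](take_takel _ le_ij) /monotone.
by case/orP=> /(take_sorted i) ->; rewrite ?orbT.
Qed.

Lemma monotone_cons3 x y z w : x != y -> y != z ->
  monotone [:: x, y, z & w] = ((y < x) == (z < y)) && monotone [:: y, z & w].
Proof.
rewrite /monotone /=; case: (ltngtP x y) => // _ _; case: (ltngtP y z) => //= _ _.
Qed.

(** A prefix of [j] letters has [j - 1] steps and is monotone exactly when these stay inside the
    first run of the pattern; hence the successor. *)
Lemma monotone_take_runs w j : uniq w -> 1 < size w -> j <= size w ->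
  monotone (take j w) = (j <= (head 0 (runs (pattern w))).+1).
Proof.
elim: w j => [|x [|y w] IHw] // j Uw _.
have neq_xy : x != y.
  by move: Uw; rewrite /= inE negb_or -andbA => /and3P[].
have neq_yx : (y == x) = false by rewrite eq_sym (negPf neq_xy).
have mono2 i : i <= 2 -> monotone (take i [:: x, y & w]).
  case: i => [|[|[|]]] // _; rewrite /monotone /= ?take0 /= ?andbT //.
  by case: ltngtP neq_xy.
case: w IHw Uw mono2 => [|z w] IHw Uw mono2 le_j.
  by rewrite mono2 //= eq_sym; case: (y < x); apply/esym; apply: leq_trans le_j _.
have neq_yz : y != z.
  by move: Uw; rewrite /= !inE !negb_or -!andbA => /and5P[_ _ _].
have ->: pattern [:: x, y, z & w] = [:: y < x, z < y & pairmap gtn z w] by [].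
have -> : head 0 (runs [:: y < x, z < y & pairmap gtn z w]) =
  if (y < x) == (z < y) then (head 0 (runs (pattern [:: y, z & w]))).+1 else 1.
  by rewrite runs_cons; case: ifP.
have h_gt0 : 0 < head 0 (runs (pattern [:: y, z & w])) by exact: runs_head_gt0.
case: (leqP j 2) => [le_j2|gt_j2].
  by rewrite mono2 //; case: ifP => _; lia.
case: j gt_j2 le_j => [|[|[|j]]] // _ le_j.
rewrite [take _ _]/= monotone_cons3 //.
have -> : [:: y, z & take j w] = take j.+2 [:: y, z & w] by [].
rewrite IHw //; last by case/andP: Uw.
by case: ifP => _ /=; rewrite ?ltnS.
Qed.

Lemma mem_positions w i j : ((i, j) \in positions w) = (i < j <= size w).
Proof.
apply/allpairsPdep/idP => [[k [l]]|lt_ij].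
  by rewrite !mem_iota => -[h1 h2 [-> ->]]; lia.
by exists i, j; rewrite !mem_iota; split=> //; lia.
Qed.

Definition shift2 (p : nat * nat) : nat * nat := (p.1.+1, p.2.+1).

Lemma positions_cons x w :
  positions (x :: w) =
  [seq (0, j) | j <- iota 1 (size w).+1] ++ map shift2 (positions w).
Proof.
rewrite /positions /=; congr (_ :: _ ++ _).
rewrite map_flatten -map_comp (iotaDl 1 0) -map_comp; congr flatten.
apply: eq_map => i /=; rewrite add1n subSS -map_comp (iotaDl 1 i.+1) -map_comp.
by apply: eq_map => j /=; rewrite add1n.
Qed.

Lemma is_birunP w p : reflect
  (monotone (factor w p) /\
   forall i j, i < j <= size w -> i <= p.1 -> p.2 <= j ->
     monotone (factor w (i, j)) -> (i, j) = p)
  (is_birun w p).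
Proof.
apply: (iffP andP) => -[mp maxp]; split=> //.
  move=> i j ij le_i le_j mij.
  have /(allP maxp) /= : (i, j) \in positions w by rewrite mem_positions.
  by rewrite le_i le_j mij /= => /eqP.
apply/allP => -[i j]; rewrite mem_positions => ij.
by apply/implyP => /and3P[] /= le_i le_j mij; apply/eqP/maxp.
Qed.

Lemma factor0 w j : factor w (0, j) = take j w.
Proof. by rewrite /factor /= subn0 drop0. Qed.

Lemma factor_shift x w p : factor (x :: w) (shift2 p) = factor w p.
Proof. by rewrite /factor /= subSS. Qed.

Lemma is_birun0 w j : uniq w -> 1 < size w -> 0 < j <= size w ->
  is_birun w (0, j) = (j == (head 0 (runs (pattern w))).+1).
Proof.
move=> Uw w_gt1 /andP[j_gt0 le_j]; set h := head _ _.
have h_lt : h.+1 <= size w.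
  rewrite /h; case: w w_gt1 {Uw le_j h} => [|x w] //= _.
  by rewrite ltnS -(size_pairmap gtn x w) head_runs_leq.
apply/is_birunP/eqP => [[]|->].
  rewrite factor0 monotone_take_runs // => le_jh maxj.
  have := maxj 0 h.+1; rewrite factor0 monotone_take_runs // leqnn /= h_lt.
  by move=> /(_ isT isT le_jh (leqnn _)) [].
rewrite factor0 monotone_take_runs //; split=> // i l /= il.
rewrite leqn0 => /eqP i0; rewrite {i}i0 in il * => lt_hl.
rewrite factor0 (monotone_take_runs Uw w_gt1); last by case/andP: il.
by move=> le_l; congr (_, _); apply/eqP; rewrite eqn_leq le_l.
Qed.

(** A monotone factor that enlarges a shifted birun of [w] must start at [x], and then it contains
    the prefix of [x :: w] ending where the birun ends. *)
Lemma is_birun_shift x w p : p.1 < p.2 <= size w ->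
  is_birun (x :: w) (shift2 p) =
  is_birun w p && ~~ monotone (take p.2.+1 (x :: w)).
Proof.
case: p => i j /= ij; apply/is_birunP/andP => [[]|[/is_birunP[] mij maxij nmono]].
  rewrite factor_shift => mij maxij; split; last first.
    apply/negP => mj; have j_le : 0 < j.+1 <= size (x :: w) by case/andP: ij.
    by have := maxij 0 j.+1 j_le isT (leqnn _); rewrite factor0 => /(_ mj).
  apply/is_birunP; split=> // i' j' ij' le_i le_j mij'.
  have := maxij i'.+1 j'.+1 ij' le_i le_j.
  by rewrite (factor_shift x w (i', j')) => /(_ mij') [-> ->].
rewrite factor_shift; split=> // -[|i'] [|j'] //= ij' le_i le_j.
  by rewrite factor0 => /(monotone_take le_j) mj; rewrite mj in nmono.
rewrite (factor_shift x w (i', j')) => mij'.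
by have <- := maxij i' j' ij' le_i le_j mij'.
Qed.

(** Induction on [w]: one birun starts at the first letter, and those of the tail remain, except the
    first of them when the new letter prolongs it. *)
Lemma birun_positions w : uniq w -> 1 < size w ->
  exists2 rest, [seq p <- positions w | is_birun w p] =
      (0, (head 0 (runs (pattern w))).+1) :: rest &
    all (fun p => 0 < p.1) rest /\
    [seq p.2 - p.1 | p <- rest] = map S (behead (runs (pattern w))).
Proof.
have first w' : uniq w' -> 1 < size w' ->
    [seq p <- [seq (0, j) | j <- iota 1 (size w')] | is_birun w' p] =
    [:: (0, (head 0 (runs (pattern w'))).+1)].
  move=> Uw w_gt1; rewrite filter_map; set h := head _ _.
  rewrite (@eq_in_filter _ _ (pred1 h.+1)); last first.
    by move=> j; rewrite mem_iota => jw /=; rewrite is_birun0 // -ltnS.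
  rewrite filter_pred1_uniq ?iota_uniq // mem_iota /=.
  rewrite /h; case: w' w_gt1 {Uw h} => [|x w'] //= _.
  by rewrite add1n !ltnS -(size_pairmap gtn x w') head_runs_leq.
elim: w => [|x [|y w] IHw] // Uw _.
rewrite positions_cons filter_cat first // filter_map.
set w1 := y :: w in IHw *.
(* [F] is the condition of [is_birun_shift] for surviving in the longer word. *)
pose F (p : nat * nat) := ~~ monotone (take p.2.+1 (x :: w1)).
rewrite (@eq_in_filter _ _ (predI F (is_birun w1))); last first.
  by case=> i j; rewrite mem_positions => ij /=; rewrite is_birun_shift // andbC.
rewrite filter_predI.
case: w @w1 @F IHw Uw => [|z w] w1 F IHw Uw.
  have mono : monotone (take 2 [:: x; y]).
    by rewrite monotone_take_runs //=; case: (y < x).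
  exists [::]; last by rewrite /=; case: (y < x).
  have -> : positions w1 = [:: (0, 1)] by [].
  by rewrite /=; case: ifP => //=; rewrite /F mono.
have Uw1 : uniq w1 by case/andP: Uw.
have [//|rest def_rest [rest_gt0 rest_runs]] := IHw Uw1.
set h := head 0 (runs (pattern w1)) in def_rest.
have h_gt0 : 0 < h by apply: runs_head_gt0.
have le_h : h.+1 <= size w1.
  by have := head_runs_leq (pattern w1); rewrite size_pairmap.
have Fh : F (0, h.+1) = ~~ (h.+2 <= (head 0 (runs (pattern (x :: w1)))).+1).
  by rewrite /F monotone_take_runs.
rewrite def_rest [filter _ (_ :: _)]/= Fh.
(* A later birun of the tail cannot end inside a monotone prefix: extended back to the start of the
   tail it would stay monotone, against maximality. *)
have -> : filter F rest = rest.
  apply/all_filterP/allP => -[i j] rest_ij; apply/negP => mono.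
  have : (i, j) \in [seq p <- positions w1 | is_birun w1 p].
    by rewrite def_rest inE rest_ij orbT.
  rewrite mem_filter mem_positions => /andP[/is_birunP[_ maxij] ij].
  have /= i_gt0 := allP rest_gt0 _ rest_ij.
  have j_le : 0 < j <= size w1 by case/andP: ij => /(leq_ltn_trans (leq0n i)) -> ->.
  have := maxij 0 j j_le isT (leqnn _); rewrite factor0.
  by case/(_ (@monotone_behead x _ mono)) => i0; rewrite -i0 in i_gt0.
have -> : pattern (x :: w1) = [:: y < x, z < y & pairmap gtn z w] by [].
have runs_w1 : runs ((z < y) :: pairmap gtn z w) = h :: behead (runs (pattern w1)).
  have headE r : 0 < head 0 r -> r = head 0 r :: behead r by case: r.
  exact: (headE (runs (pattern w1))).
rewrite runs_cons runs_w1; case: eqP => _.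
  exists (map shift2 rest); first by rewrite /= ltnS leqnn.
  by rewrite all_map; split; [apply/allP | rewrite -map_comp -rest_runs].
exists (map shift2 ((0, h.+1) :: rest)); first by rewrite /= ltnS ltnNge h_gt0.
rewrite all_map; split; first exact/allP.
by rewrite -map_comp /= subSS subn0 -rest_runs.
Qed.

Lemma typeE w : uniq w -> 1 < size w -> type w = map S (runs (pattern w)).
Proof.
move=> Uw w_gt1; rewrite /type /biruns -map_comp.
have [rest def_rest [_ rest_runs]] := birun_positions Uw w_gt1.
transitivity [seq p.2 - p.1 | p <- positions w & is_birun w p].
  apply/eq_in_map => -[i j]; rewrite mem_filter mem_positions => /andP[_ ij] /=.
  by rewrite size_takel // size_drop /=; lia.
rewrite def_rest /= rest_runs subn0.
by case: w w_gt1 {Uw def_rest rest_runs} => [|x [|y w]] //= _; case: ifP; case: (runs _).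
Qed.

(** * Insertion of factors into the gaps *)

Definition nonempty (f : seq nat) : bool := f != [::].

Fixpoint ud (s : bitseq) : nat :=
  if s is b :: s' then (~~ b && head false s') + ud s' else 0.

(** The extra term is a factor UD across the junction; the default [true] of [last] switches it off
    when [s1] is empty. *)
Lemma ud_cat s1 s2 :
  ud (s1 ++ s2) = ud s1 + ud s2 + (~~ last true s1 && head false s2).
Proof.
elim: s1 => [|b s1 IHs] /=; first by rewrite addn0.
rewrite IHs; case: s1 {IHs} => [|c s1] /=; lia.
Qed.

(* [fs] lists the factors put before each letter of [p], and [e] comes last. *)
Fixpoint weave (p : seq nat) (fs : seq (seq nat)) (e : seq nat) : seq nat :=
  match p, fs with
  | x :: p', f :: fs' => f ++ x :: weave p' fs' e
  | _, _ => e
  end.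

(** The letters of [f] exceed those of the base word, so the pattern goes up into [f] and down after
    it. *)
Definition blk (b : bool) (f : seq nat) : bitseq :=
  if f is y :: f' then false :: rcons (pairmap gtn y f') true else [:: b].

Fixpoint blocks (s : bitseq) (fs : seq (seq nat)) : bitseq :=
  match s, fs with
  | b :: s', f :: fs' => blk b f ++ blocks s' fs'
  | _, _ => [::]
  end.

Definition tail_pattern (e : seq nat) : bitseq :=
  if e is y :: e' then false :: pairmap gtn y e' else [::].

Lemma pairmap_weave n x p fs e : size fs = size p -> all (geq n) (x :: p) ->
  all (ltn n) (flatten fs ++ e) ->
  pairmap gtn x (weave p fs e) = blocks (pairmap gtn x p) fs ++ tail_pattern e.
Proof.
elim: p x fs => [|y p IHp] x [|f fs] //=.
  case: e => [|z e] //= _ /andP[le_xn _] /andP[lt_nz _].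
  by congr (_ :: _); apply/negbTE; rewrite -leqNgt; apply: leq_trans le_xn (ltnW _).
move=> [sz_fs] /and3P[le_xn le_yn le_p]; rewrite -catA all_cat => /andP[gt_f gt_fs].
rewrite pairmap_cat -catA /= IHp //= ?le_yn // {IHp}.
case: f gt_f => [|z f] //= /andP[lt_nz gt_f].
have -> : (z < x) = false by lia.
have lt_n : n < last z f.
  by have /allP /(_ _ (mem_last z f)) : all (ltn n) (z :: f) by rewrite /= lt_nz.
have -> : (y < last z f) = true by lia.
by rewrite cat_rcons.
Qed.

(* Bits of a mask on the tokens UD, on the tokens U and on the tokens D. *)
Definition token3 := (seq (bool * bool) * bitseq * bitseq)%type.

(** A U followed by D is always read as one token; as factors UD are disjoint, the cutting into
    tokens is unique. *)
Fixpoint split_mask (s g : bitseq) : token3 :=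
  match s, g with
  | false :: true :: s', a :: b :: g' =>
      let: (ps, us, ds) := split_mask s' g' in ((a, b) :: ps, us, ds)
  | false :: s', a :: g' => let: (ps, us, ds) := split_mask s' g' in (ps, a :: us, ds)
  | true :: s', a :: g' => let: (ps, us, ds) := split_mask s' g' in (ps, us, a :: ds)
  | _, _ => ([::], [::], [::])
  end.

Fixpoint join_mask (s : bitseq) (t : token3) : bitseq :=
  let: (ps, us, ds) := t in
  match s with
  | false :: true :: s' =>
      [:: (head (false, false) ps).1, (head (false, false) ps).2
        & join_mask s' (behead ps, us, ds)]
  | false :: s' => head false us :: join_mask s' (ps, behead us, ds)
  | true :: s' => head false ds :: join_mask s' (ps, us, behead ds)
  | [::] => [::]
  end.

(** Induction token by token; the third case is a U that starts no factor UD. *)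
Lemma ud_ind (P : bitseq -> Prop) :
    P [::] -> (forall s, P s -> P [:: false, true & s]) ->
    (forall s, head false s = false -> P s -> P (false :: s)) ->
    (forall s, P s -> P (true :: s)) ->
  forall s, P s.
Proof.
move=> P0 Pp Pu Pd s.
(* A token UD removes two letters, so the claim is carried for [s] and its tail together. *)
suff [] : P s /\ P (behead s) by [].
elim: s => [|[] s [Ps Ps']] //; split=> //; first exact: Pd.
by case: s Ps Ps' => [|[] s] Ps Ps'; [apply: Pu | apply: Pp | apply: Pu].
Qed.

Lemma ud_leU s : ud s <= count negb s.
Proof. by elim/ud_ind: s => [|s|s s0|s] //=; rewrite ?s0 /=; lia. Qed.

Lemma ud_leD s : ud s <= count id s.
Proof. by elim/ud_ind: s => [|s|s s0|s] //=; rewrite ?s0 /=; lia. Qed.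

Lemma split_maskU s a g : head false s = false ->
  split_mask (false :: s) (a :: g) =
  let: (ps, us, ds) := split_mask s g in (ps, a :: us, ds).
Proof. by case: s => [|[] s]. Qed.

Lemma join_maskU s ps us ds : head false s = false ->
  join_mask (false :: s) (ps, us, ds) =
  head false us :: join_mask s (ps, behead us, ds).
Proof. by case: s => [|[] s]. Qed.

(** Subtracting the factors UD from the letters U, or from the letters D, counts the single tokens;
    sums avoid truncated subtraction. *)
Definition fits (s : bitseq) (t : token3) : bool :=
  let: (ps, us, ds) := t in
  [&& size ps == ud s, size us + ud s == count negb s & size ds + ud s == count id s].

Lemma split_mask_fits s g : size g = size s -> fits s (split_mask s g).
Proof.
elim/ud_ind: s g => [|s IHs|s s0 IHs|s IHs] [|a g] //.
- case: g => [|b g] //= [/IHs]; case: (split_mask s g) => [[ps us] ds] /=; lia.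
- move=> [/IHs]; rewrite split_maskU //.
  case: (split_mask s g) => [[ps us] ds] /=; rewrite s0 /=; lia.
- move=> /= [/IHs]; case: (split_mask s g) => [[ps us] ds] /=; lia.
Qed.

Lemma split_maskK s g : size g = size s -> join_mask s (split_mask s g) = g.
Proof.
elim/ud_ind: s g => [|s IHs|s s0 IHs|s IHs] [|a g] //.
- case: g => [|b g] //= [/IHs]; case: (split_mask s g) => [[ps us] ds] /=.
  by move->.
- move=> [/IHs]; rewrite split_maskU //.
  by case: (split_mask s g) => [[ps us] ds] eg; rewrite join_maskU //= eg.
- by move=> /= [/IHs]; case: (split_mask s g) => [[ps us] ds] /= ->.
Qed.

(** With [split_maskK], the masks on [s] correspond bijectively to the triples that fit [s], and
    fitting depends only on the numbers of U, D and UD in [s]. *)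
Lemma join_maskK s t : fits s t -> split_mask s (join_mask s t) = t.
Proof.
elim/ud_ind: s t => [|s IHs|s s0 IHs|s IHs] [[ps us] ds].
- by case: ps us ds => [|p ps] [|u us] [|d ds] //=; lia.
- case: ps => [|[a b] ps] /=; first by lia.
  by move=> fit; rewrite IHs //=; lia.
- rewrite /fits [ud _]/= s0 => fit; rewrite join_maskU // split_maskU //.
  case: us fit => [|u us] /=; last by move=> fit; rewrite IHs //=; lia.
  (* An empty [us] would give the rest of the pattern more factors UD than letters U. *)
  by have := ud_leU s; lia.
- rewrite /= => fit; case: ds fit => [|u ds] /=; last by move=> fit; rewrite IHs //=; lia.
  by have := ud_leD s; lia.
Qed.

Definition token_card (t : token3) : nat :=
  let: (ps, us, ds) := t in
  count fst ps + count snd ps + count id us + count id ds.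

Definition token_des (t : token3) : nat :=
  let: (ps, us, ds) := t in count (fun p => ~~ p.2) ps + count negb ds.

Definition token_ud (t : token3) : nat :=
  let: (ps, us, ds) := t in count (fun p => ~~ p.1 && ~~ p.2) ps.

Lemma count_split_mask s g : size g = size s ->
  count id g = token_card (split_mask s g).
Proof.
elim/ud_ind: s g => [|s IHs|s s0 IHs|s IHs] [|a g] //.
- case: g => [|b g] //= [/IHs]; case: (split_mask s g) => [[ps us] ds] /=; lia.
- move=> [/IHs]; rewrite split_maskU //.
  case: (split_mask s g) => [[ps us] ds] /=; lia.
- move=> /= [/IHs]; case: (split_mask s g) => [[ps us] ds] /=; lia.
Qed.

(** Separates what [f] contributes by itself from a letter D surviving at an empty gap. *)
Lemma count_blk b f : count id (blk b f) = count id (blk false f) + (b && ~~ nonempty f).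
Proof. by case: f => [|y f] /=; rewrite ?andbF ?andbT ?addn0 //; case: b. Qed.

Lemma ud_blk b f : ud (blk b f) = ud (blk false f).
Proof. by case: f => [|y f] //=; case: b. Qed.

Lemma head_blk b f s : head false (blk b f ++ s) = b && ~~ nonempty f.
Proof. by case: f => [|y f] /=; rewrite ?andbT ?andbF. Qed.

Lemma last_blk x b f : last x (blk b f) = b || nonempty f.
Proof. by case: f => [|y f] /=; rewrite ?orbF // last_rcons orbT. Qed.

Lemma head_blocks s fs : head false s = false -> head false (blocks s fs) = false.
Proof. by case: s fs => [|b s] [|f fs] //= ->; rewrite head_blk. Qed.

Lemma count_blocks s fs : size fs = size s ->
  count id (blocks s fs) = sumn [seq count id (blk false f) | f <- fs]
    + token_des (split_mask s (map nonempty fs)).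
Proof.
elim/ud_ind: s fs => [|s IHs|s s0 IHs|s IHs] [|f fs] //.
- case: fs => [|f' fs] // [/IHs] /=.
  case: (split_mask s _) => [[ps us] ds] /=.
  by rewrite !count_cat [count id (blk true _)]count_blk /=; lia.
- move=> [/IHs]; rewrite map_cons split_maskU //.
  by case: (split_mask s _) => [[ps us] ds] /=; rewrite count_cat; lia.
- move=> [/IHs] /=.
  case: (split_mask s _) => [[ps us] ds] /=.
  by rewrite !count_cat [count id (blk true _)]count_blk /=; lia.
Qed.

(** A nonempty factor gives a block starting with U and ending with D, so a factor UD across two
    blocks comes from a token UD with both gaps empty. *)
Lemma ud_blocks s fs : size fs = size s ->
  ud (blocks s fs) = sumn [seq ud (blk false f) | f <- fs]
    + token_ud (split_mask s (map nonempty fs)).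
Proof.
elim/ud_ind: s fs => [|s IHs|s s0 IHs|s IHs] [|f fs] //.
- case: fs => [|f' fs] // [/IHs] /=.
  case: (split_mask s _) => [[ps us] ds] /=.
  by rewrite !ud_cat [ud (blk true _)]ud_blk !last_blk head_blk /=; lia.
- move=> [/IHs]; rewrite map_cons split_maskU //.
  case: (split_mask s _) => [[ps us] ds] /=.
  by rewrite ud_cat head_blocks // andbF; lia.
- move=> [/IHs] /=.
  case: (split_mask s _) => [[ps us] ds] /=.
  by rewrite !ud_cat [ud (blk true _)]ud_blk last_blk /=; lia.
Qed.

(* [y] is arbitrary: if there is no token U then [s] ends in D. *)
Lemma last_blocks s fs x y : size fs = size s -> 0 < size s ->
  last x (blocks s fs) =
  last x s || last y (split_mask s (map nonempty fs)).1.2.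
Proof.
elim/ud_ind: s fs x y => [|s IHs|s s0 IHs|s IHs] [|f fs] x y //.
- case: fs => [|f' fs] // [sz_fs] _.
  rewrite [blocks _ _]/= [map _ _]/= [split_mask _ _]/= !last_cat last_blk /=.
  case: s fs sz_fs IHs => [|b s] [|f2 fs] // sz_fs IHs.
  rewrite (IHs _ _ y) //.
  by case: (split_mask _ _) => [[ps us] ds].
- move=> [sz_fs] _.
  rewrite map_cons split_maskU // [blocks _ _]/= last_cat last_blk.
  case: s s0 fs sz_fs IHs => [|b s] s0 [|f2 fs] // sz_fs IHs.
  rewrite (IHs _ _ (nonempty f)) //.
  by case: (split_mask _ _) => [[ps us] ds].
- move=> [sz_fs] _.
  rewrite [blocks _ _]/= [map _ _]/= [split_mask _ _]/= last_cat last_blk.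
  case: s fs sz_fs IHs => [|b s] [|f2 fs] // sz_fs IHs.
  rewrite (IHs _ _ y) //.
  by case: (split_mask _ _) => [[ps us] ds].
Qed.

(* The second letter of a pattern after insertion of the factors [c], [b] telling
   whether the pattern starts with UD. *)
Definition token_snd (b : bool) (c : seq (seq nat)) (t : token3) : bool :=
  let: (ps, us, ds) := t in
  let: (u, v) := if b then head (false, false) ps else (head false us, true) in
  if u then nth false (blk false (head [::] c)) 1 else ~~ v.

(** If the first gap is filled, its block supplies the second letter; otherwise that letter is D
    only when the pattern starts with UD and this D is kept. *)
Lemma nth_blocks s fs : size fs = (size s).+1 ->
  nth false (blocks (false :: s) fs) 1 =
  token_snd (head false s) (filter nonempty fs)
    (split_mask (false :: s) (map nonempty fs)).
Proof.
case: fs => [|f fs] // [sz_fs]; case s0 : (head false s).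
  case: s fs s0 sz_fs => [|[] s] [|f' fs] // _ [sz_fs].
  rewrite [split_mask _ _]/=; case: (split_mask s _) => [[ps us] ds] /=.
  by case: f => [|y f] /=; [case: f' | case: f].
rewrite map_cons split_maskU //.
case: (split_mask s _) => [[ps us] ds] /=.
case: f => [|y f] /=; last by case: f.
by case: s fs s0 sz_fs => [|b s] [|f' fs] //= -> _; case: f'.
Qed.

Lemma size_blocks s fs : size fs = size s ->
  size (blocks s fs) = size s + size (flatten fs).
Proof.
elim: s fs => [|b s IHs] [|f fs] //= [/IHs sz]; rewrite !size_cat sz.
by case: f => [|y f] //=; rewrite size_rcons size_pairmap; lia.
Qed.

(** * Carrying factors from one pattern to another *)

Fixpoint refill (g : bitseq) (c : seq (seq nat)) : seq (seq nat) :=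
  if g is b :: g' then
    if b then head [::] c :: refill g' (behead c) else [::] :: refill g' c
  else [::].

Lemma size_refill g c : size (refill g c) = size g.
Proof. by elim: g c => [|[] g IHg] c //=; rewrite IHg. Qed.

Lemma refill_filter fs : refill (map nonempty fs) (filter nonempty fs) = fs.
Proof. by elim: fs => [|[|y f] fs IHfs] //=; rewrite IHfs. Qed.

(** With [refill_filter], filling the gaps amounts to choosing a mask and a list of as many nonempty
    factors. *)
Lemma refill_mask g c : all nonempty c -> count id g = size c ->
  map nonempty (refill g c) = g /\ filter nonempty (refill g c) = c.
Proof.
elim: g c => [|[] g IHg] c //=; first by case: c.
  case: c => [|f c] //= /andP[-> /IHg{}IHg] [/IHg[-> ->]].
  by [].
by move=> /IHg{}IHg /IHg[-> ->].
Qed.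

Lemma flatten_filter (fs : seq (seq nat)) : flatten (filter nonempty fs) = flatten fs.
Proof. by elim: fs => [|[|y f] fs IHfs] //=; rewrite IHfs. Qed.

Lemma sumn_filter (F : seq nat -> nat) fs : F [::] = 0 ->
  sumn (map F (filter nonempty fs)) = sumn (map F fs).
Proof. by move=> F0; elim: fs => [|[|y f] fs IHfs] //=; rewrite IHfs ?F0. Qed.

(** The nonempty factors keep their order and the tokens of each kind keep their bits; only the
    places of the tokens change. *)
Definition regap (s s' : bitseq) (fs : seq (seq nat)) : seq (seq nat) :=
  refill (join_mask s' (split_mask s (map nonempty fs))) (filter nonempty fs).

Lemma size_join_mask s t : size (join_mask s t) = size s.
Proof.
elim/ud_ind: s t => [|s IHs|s s0 IHs|s IHs] [[ps us] ds] //.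
- by rewrite /= IHs.
- by rewrite join_maskU //= IHs.
- by rewrite /= IHs.
Qed.

Lemma count_negb s : count negb s + count id s = size s.
Proof. by elim: s => //= -[] s <-; lia. Qed.

Section Regap.

Variables (s s' : bitseq) (fs : seq (seq nat)).
Hypotheses (eq_size : size s = size s') (eq_ud : ud s = ud s')
  (eq_count : count id s = count id s') (sz_fs : size fs = size s).

Lemma regap_spec :
  [/\ size (regap s s' fs) = size s',
      filter nonempty (regap s s' fs) = filter nonempty fs &
      split_mask s' (map nonempty (regap s s' fs)) = split_mask s (map nonempty fs)].
Proof.
have sz_g : size (map nonempty fs) = size s by rewrite size_map.
have fit : fits s' (split_mask s (map nonempty fs)).
  have := split_mask_fits sz_g; rewrite /fits -eq_ud -eq_count.
  have -> // : count negb s = count negb s'.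
  by have := (count_negb s, count_negb s') => -[]; lia.
have [] := @refill_mask (join_mask s' (split_mask s (map nonempty fs))) (filter nonempty fs).
- exact: filter_all.
(* The number of marked places depends only on the token bits, so it still equals the number of
   nonempty factors. *)
- rewrite (count_split_mask (size_join_mask _ _)) join_maskK //.
  by rewrite -count_split_mask // size_filter count_map.
rewrite -/(regap s s' fs) => eq_mask ->.
by split=> //; rewrite ?eq_mask ?join_maskK // size_refill size_join_mask.
Qed.

Lemma regapK : regap s' s (regap s s' fs) = fs.
Proof.
have [_ eq_c eq_t] := regap_spec.
by rewrite {1}/regap eq_c eq_t split_maskK ?size_map // refill_filter.
Qed.

Lemma flatten_regap : flatten (regap s s' fs) = flatten fs.
Proof. by have [_ eq_c _] := regap_spec; rewrite -flatten_filter eq_c flatten_filter. Qed.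

End Regap.

(** * Shuffle compatibility *)

(** Each factor UD pairs a run of U with the following run of D; only an initial run of D and a
    final run of U stay unpaired. *)
Lemma size_runs b s :
  size (runs (b :: s)) = (ud (b :: s)).*2 + b + ~~ last b s.
Proof.
elim: s b => [|c s IHs] b; first by case: b.
rewrite runs_cons; move: (IHs c); case: eqP => [<-|neq_bc] IH.
  transitivity (size (runs (b :: s))); last by rewrite IH; case: (b) => /=; lia.
  by have := runs_head_gt0 b s; case: (runs _).
rewrite [size _]/= IH; case: b c neq_bc {IHs IH} => [] [] // _ /=; lia.
Qed.

Lemma des_pattern w : des w = count id (pattern w).
Proof.
rewrite /des; case: w => [|x w] //=.
elim: w x => [|y w IHw] x //=; congr (_ + _).
by rewrite -IHw (iotaDl 1 0) count_map; apply: eq_count.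
Qed.

Lemma pk_pattern w : uniq w -> pk w = ud (pattern w).
Proof.
rewrite /pk; elim: w => [|x [|y [|z w]] IHw] // Uw; first by rewrite /= andbF.
have neq_xy : x != y by move: Uw; rewrite /= inE negb_or -andbA => /and3P[].
have -> : iota 1 (size [:: x, y, z & w] - 2) =
    1 :: map S (iota 1 (size [:: y, z & w] - 2)).
  by rewrite /= !subSS !subn0 /= -(eq_map add1n) -iotaDl.
rewrite [LHS]/= count_map.
transitivity ((~~ (y < x) && (z < y)) + ud (pattern [:: y, z & w])); last by [].
rewrite -IHw; last by case/andP: Uw.
congr (_ + _); first by case: ltngtP neq_xy.
by apply: eq_in_count => -[|i] //; rewrite mem_iota.
Qed.

(** [T] is the pattern of [0 :: w] and starts with U. If its second letter is D, the first factor UD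
    is a peak at the first letter of [w], which [pk w] does not count. *)
Lemma statE w : uniq (0 :: w) -> 0 < size w ->
  let T := pairmap gtn 0 w in
  stat w = ((ud T).*2 + ~~ last false T, ud T - nth false T 1, count id T).
Proof.
move=> Uw w_gt0; rewrite /stat /udr des_pattern pk_pattern; last by case/andP: Uw.
rewrite -(size_map size) -/(type (0 :: w)) typeE // size_map.
case: w w_gt0 {Uw} => [|x w] // _.
rewrite [pattern (0 :: _)]/= size_runs /= addn0 add0n; congr (_, _, _).
by case: w => [|y w] //=; rewrite addKn.
Qed.

Lemma perm_map_bij (A B C : eqType) (s : seq A) (t : seq B)
    (f : A -> C) (g : B -> C) (h : A -> B) (k : B -> A) :
    uniq s -> uniq t ->
    (forall x, x \in s -> [/\ h x \in t, k (h x) = x & f x = g (h x)]) ->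
    (forall y, y \in t -> k y \in s /\ h (k y) = y) ->
  perm_eq (map f s) (map g t).
Proof.
move=> Us Ut hP kP.
have -> : map f s = map g (map h s).
  by rewrite -map_comp; apply/eq_in_map => x /hP[].
apply/perm_map/uniq_perm => //.
  by rewrite map_inj_in_uniq // => x y /hP[_ kx _] /hP[_ ky _] eq_h; rewrite -kx eq_h.
move=> y; apply/mapP/idP => [[x /hP[hx _ _] ->] //|/kP[ky hk]].
by exists (k y).
Qed.

(** * Shuffles as fillings of gaps *)

Fixpoint gaps (p t : seq nat) : seq (seq nat) * seq nat :=
  if p is x :: p' then
    let r := gaps p' (drop (index x t).+1 t) in (take (index x t) t :: r.1, r.2)
  else ([::], t).

Lemma size_gaps p t : size (gaps p t).1 = size p.
Proof. by elim: p t => [|x p IHp] t //=; rewrite IHp. Qed.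

Lemma gapsK p t : subseq p t -> weave p (gaps p t).1 (gaps p t).2 = t.
Proof.
elim: p t => [|x p IHp] t //= sub.
have x_t : x \in t by apply: (mem_subseq sub); rewrite inE eqxx.
(* Past the first occurrence of [x], the rest of [p] is still a subsequence. *)
rewrite IHp; last first.
  elim: t sub x_t {IHp} => [|y t IHt] //=; rewrite inE [y == x]eq_sym.
  by case: (x == y) => /=; [rewrite drop0 | apply: IHt].
have := cat_take_drop (index x t) t.
by rewrite [drop (index x t) t](drop_nth 0) ?index_mem // nth_index.
Qed.

(** As no letter of [p] lies in the factors, each first occurrence found by [gaps] is the letter
    placed by [weave]. *)
Lemma weaveK p fs e : size fs = size p ->
  (forall x, x \in p -> x \notin flatten fs) -> gaps p (weave p fs e) = (fs, e).
Proof.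
elim: p fs => [|x p IHp] [|f fs] //= [sz_fs] disj.
have x_f : x \notin f.
  by have := disj x; rewrite inE eqxx mem_cat negb_or => /(_ isT)/andP[].
rewrite index_cat (negPf x_f) /= eqxx addn0 take_size_cat //.
rewrite -cat_rcons drop_size_cat ?size_rcons // IHp // => y y_p.
by have := disj y; rewrite inE y_p orbT mem_cat negb_or => /(_ isT)/andP[].
Qed.

Lemma perm_weave p fs e : size fs = size p ->
  perm_eq (weave p fs e) (p ++ (flatten fs ++ e)).
Proof.
elim: p fs => [|x p IHp] [|f fs] //= [sz_fs].
rewrite -cat1s perm_catCA /= perm_cons -catA perm_sym perm_catCA perm_cat2l perm_sym.
exact: IHp.
Qed.

Lemma subseq_weavel p fs e : size fs = size p -> subseq p (weave p fs e).
Proof.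
elim: p fs => [|x p IHp] [|f fs] //=; first by rewrite sub0seq.
move=> [sz_fs].
by rewrite -[x :: p]cat0s cat_subseq ?sub0seq //= eqxx IHp.
Qed.

Lemma subseq_weaver p fs e : size fs = size p ->
  subseq (flatten fs ++ e) (weave p fs e).
Proof.
elim: p fs => [|x p IHp] [|f fs] //= [sz_fs].
rewrite -catA cat_subseq //; apply: subseq_trans (subseq_cons _ _).
exact: IHp.
Qed.

Lemma filter_weave (n : nat) p fs e : size fs = size p -> all (geq n) p ->
  all (ltn n) (flatten fs ++ e) -> filter (ltn n) (weave p fs e) = flatten fs ++ e.
Proof.
elim: p fs => [|x p IHp] [|f fs] //=; first by move=> _ _ /all_filterP.
move=> [sz_fs] /andP[le_x le_p]; rewrite -!catA all_cat => /andP[gt_f gt_fs].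
by rewrite filter_cat /= ltnNge le_x /= IHp // (all_filterP gt_f).
Qed.

Section Compatible.

Variables (n m : nat) (sigma : seq nat).
Hypothesis (hsigma : sigma \in L (iota n.+1 m)).

Let sigma_gt : all (ltn n) sigma.
Proof. by rewrite (perm_all _ hsigma); apply/allP => x; rewrite mem_iota => /andP[]. Qed.

Lemma L_le p : p \in L (iota 1 n) -> all (geq n) p.
Proof.
move=> hp; rewrite (perm_all _ hp); apply/allP => x.
by rewrite mem_iota add1n ltnS => /andP[].
Qed.

Lemma L_uniq p : p \in L (iota 1 n) -> uniq (0 :: p).
Proof. by move=> hp; rewrite /= (perm_mem hp) mem_iota (perm_uniq hp) iota_uniq. Qed.

Lemma uniq_cat_sigma p : p \in L (iota 1 n) -> uniq (0 :: (p ++ sigma)).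
Proof.
move=> hp; have := perm_cat hp hsigma; rewrite -add1n -iotaD => hps.
by rewrite /= (perm_mem hps) mem_iota (perm_uniq hps) iota_uniq.
Qed.

(** The concatenated factors and [sigma] both list the letters of [t] exceeding [n], in the order of
    [t]. *)
Lemma gaps_shuffle p t : p \in L (iota 1 n) -> t \in shuffles p sigma ->
  weave p (gaps p t).1 (gaps p t).2 = t /\
  flatten (gaps p t).1 ++ (gaps p t).2 = sigma.
Proof.
move=> hp; rewrite mem_filter mem_permutations => /andP[/andP[sub_p sub_s] tps].
have def_t := gapsK sub_p; split=> //.
have sz := size_gaps p t.
have gt_fs : perm_eq (flatten (gaps p t).1 ++ (gaps p t).2) sigma.
  by rewrite -(perm_cat2l p) -(permPl (perm_weave _ sz)) def_t.
have Ut : uniq t.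
  by rewrite (perm_uniq tps); have /andP[] := uniq_cat_sigma hp.
have -> : sigma = filter (ltn n) t.
  have /(subseq_uniqP Ut) {1}-> := sub_s; apply: eq_in_filter => x.
  rewrite (perm_mem tps) mem_cat => /orP[x_p|x_s]; last first.
    by rewrite x_s (allP sigma_gt).
  have := allP (L_le hp) _ x_p => /= le_x; rewrite ltnNge le_x /=.
  by apply/negbTE/negP => /(allP sigma_gt) /=; rewrite ltnNge le_x.
by rewrite -[in RHS]def_t filter_weave ?L_le // (perm_all _ gt_fs).
Qed.

Lemma weave_shuffle p fs e : p \in L (iota 1 n) -> size fs = size p ->
  flatten fs ++ e = sigma ->
  weave p fs e \in shuffles p sigma /\ gaps p (weave p fs e) = (fs, e).
Proof.
move=> hp sz_fs def_s; split.
  by rewrite mem_filter mem_permutations subseq_weavel // -def_s subseq_weaver // perm_weave.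
apply: weaveK => // x /(allP (L_le hp)) /= le_x; apply/negP => x_fs.
have : x \in sigma by rewrite -def_s mem_cat x_fs.
by move/(allP sigma_gt); rewrite /= ltnNge le_x.
Qed.

Let spat (p : seq nat) : bitseq := pairmap gtn 0 p.

Lemma stat_weave p fs e : p \in L (iota 1 n) -> size fs = size p -> 0 < size p ->
  flatten fs ++ e = sigma ->
  let T := blocks (spat p) fs ++ tail_pattern e in
  stat (weave p fs e) = ((ud T).*2 + ~~ last false T, ud T - nth false T 1, count id T).
Proof.
move=> hp sz_fs p_gt0 def_s T.
have perm_t := perm_weave e sz_fs; rewrite def_s in perm_t.
rewrite statE.
- by rewrite (@pairmap_weave n) //= ?L_le // def_s.
- by rewrite /= (perm_mem perm_t) (perm_uniq perm_t); exact: uniq_cat_sigma.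
- by rewrite (perm_size perm_t) size_cat addn_gt0 p_gt0.
Qed.

Definition reshuffle p q t := weave q (regap (spat p) (spat q) (gaps p t).1) (gaps p t).2.

(** By parity, [udr] determines both the number of UD and the last letter; then [pk] determines the
    second letter. *)
Lemma stat_eq_pattern p q : p \in L (iota 1 n) -> q \in L (iota 1 n) -> stat p = stat q -> 0 < n ->
  [/\ ud (spat p) = ud (spat q), count id (spat p) = count id (spat q),
      nth false (spat p) 1 = nth false (spat q) 1,
      last false (spat p) = last false (spat q) & size (spat p) = size (spat q)].
Proof.
move=> hp hq + n_gt0.
have szp : size p = n by rewrite (perm_size hp) size_iota.
have szq : size q = n by rewrite (perm_size hq) size_iota.
rewrite !statE ?L_uniq ?szp ?szq // -/(spat p) -/(spat q) !size_pairmap szp szq.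
(* This makes the subtraction in the formula for [pk] exact. *)
have le_ud w : nth false (spat w) 1 <= ud (spat w).
  by case: w => [|x [|y w]] //=; case: (y < x).
have hp1 := le_ud p; have hq1 := le_ud q; case=> e1 e2 e3.
have eu : ud (spat p) = ud (spat q).
  by move: e1; case: (last _ _); case: (last _ _) => /=; lia.
split=> //.
  by move: hp1 hq1 e2; rewrite eu; do 2!case: (nth _ _ _) => //=; lia.
by move: e1; rewrite eu; do 2!case: (last _ _) => //=; lia.
Qed.

Lemma reshuffleP p q t : p \in L (iota 1 n) -> q \in L (iota 1 n) ->
  stat p = stat q -> 0 < n -> t \in shuffles p sigma ->
  [/\ reshuffle p q t \in shuffles q sigma, reshuffle q p (reshuffle p q t) = t
    & stat t = stat (reshuffle p q t)].
Proof.
move=> hp hq eq_st n_gt0 ht.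
have [eq_ud eq_count eq_snd eq_last eq_size] := stat_eq_pattern hp hq eq_st n_gt0.
have szp : size p = n by rewrite (perm_size hp) size_iota.
have szq : size q = n by rewrite (perm_size hq) size_iota.
have [def_t def_s] := gaps_shuffle hp ht.
rewrite /reshuffle; move: (size_gaps p t) def_t def_s.
case: (gaps p t) => fs e /= sz_fs def_t def_s.
have sz_fs' : size fs = size (spat p) by rewrite size_pairmap.
have [sz_r eq_c eq_t] := regap_spec eq_size eq_ud eq_count sz_fs'.
have def_s' : flatten (regap (spat p) (spat q) fs) ++ e = sigma by rewrite flatten_regap.
have sz_r' : size (regap (spat p) (spat q) fs) = size q by rewrite sz_r size_pairmap.
have [mem_r ->] := weave_shuffle hq sz_r' def_s'.
split=> //=; first by rewrite regapK.
rewrite -{1}def_t !stat_weave ?sz_fs ?sz_r' ?szp ?szq //.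
set fs' := regap _ _ _ in sz_r eq_c eq_t sz_r' def_s' *.
(* Empty factors contribute nothing, so such sums depend on the nonempty factors only. *)
have sum_eq F : F [::] = 0 -> sumn (map F fs) = sumn (map F fs').
  by move=> F0; rewrite -(sumn_filter fs F0) -eq_c sumn_filter.
have -> : count id (blocks (spat p) fs ++ tail_pattern e) =
          count id (blocks (spat q) fs' ++ tail_pattern e).
  by rewrite !count_cat !count_blocks // eq_t sum_eq.
have -> : ud (blocks (spat p) fs ++ tail_pattern e) =
          ud (blocks (spat q) fs' ++ tail_pattern e).
  rewrite !ud_cat !ud_blocks // eq_t sum_eq //.
  (* The pattern of [e] never starts with D, so no factor UD crosses into it. *)
  have -> : head false (tail_pattern e) = false by case: (e).
  by rewrite !andbF.
have -> : last false (blocks (spat p) fs ++ tail_pattern e) =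
          last false (blocks (spat q) fs' ++ tail_pattern e).
  rewrite !last_cat (last_blocks false false) ?size_pairmap ?sz_fs ?szp //.
  by rewrite (last_blocks false false) ?size_pairmap ?sz_r' ?szq // eq_t eq_last.
have -> // : nth false (blocks (spat p) fs ++ tail_pattern e) 1 =
          nth false (blocks (spat q) fs' ++ tail_pattern e) 1.
(* The block parts have equal length on both sides, so index 1 falls in the same part. *)
rewrite !nth_cat !size_blocks // !size_pairmap szp szq flatten_regap //.
case: ifP => // _.
have spatE w : 0 < size w -> spat w = false :: behead (spat w) by case: w.
have sndE (w : bitseq) : nth false w 1 = head false (behead w) by case: w => [|? []].
have size_behead w : 0 < size w -> (size (behead (spat w))).+1 = size w.
  by move=> w_gt0; rewrite -[LHS]/(size (false :: _)) -spatE // size_pairmap.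
rewrite (spatE p) ?szp // (spatE q) ?szq //.
rewrite !nth_blocks ?size_behead ?szp ?szq //; try by rewrite ?sz_fs ?sz_r'.
by rewrite -!spatE ?szp ?szq // eq_t eq_c -!sndE eq_snd.
Qed.

Lemma statS_compat p q : p \in L (iota 1 n) -> q \in L (iota 1 n) -> 0 < n ->
  stat p = stat q -> perm_eq (statS p sigma) (statS q sigma).
Proof.
move=> hp hq n_gt0 eq_st; rewrite /statS.
apply: (@perm_map_bij _ _ _ _ _ stat stat (reshuffle p q) (reshuffle q p)).
- by rewrite filter_uniq ?permutations_uniq.
- by rewrite filter_uniq ?permutations_uniq.
- by move=> t; apply: reshuffleP.
- by move=> t /(reshuffleP hq hp (esym eq_st) n_gt0)[].
Qed.

End Compatible.

(** * Hook-shaped patterns *)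

(** Letters are added in front: a new maximum creates a descent; a new minimum, the others being
    shifted up, creates an ascent. *)
Lemma pattern_realizable (s : bitseq) :
  exists2 w, w \in L (iota 1 (size s).+1) & pattern w = s.
Proof.
elim: s => [|b s [w hw pat_w]]; first by exists [:: 1].
have szw : size w = (size s).+1 by rewrite (perm_size hw) size_iota.
case: b.
  exists ((size s).+2 :: w).
    have def_iota : iota 1 (size s).+2 = iota 1 (size s).+1 ++ [:: (size s).+2].
      by rewrite -[in LHS](addn1 (size s).+1) iotaD.
    rewrite -[_ \in _]/(perm_eq ((size s).+2 :: w) (iota 1 (size s).+2)) def_iota.
    by rewrite -cat1s perm_catC perm_cat.
  case: w hw pat_w {szw} => [|x w] hw /=; first by have := perm_size hw.
  move=> ->; congr (_ :: _); have : x \in x :: w by rewrite inE eqxx.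
  by rewrite (perm_mem hw) mem_iota add1n => /andP[].
exists (1 :: map S w).
  rewrite -[_ \in _]/(perm_eq (1 :: map S w) (1 :: iota 2 (size s).+1)) perm_cons.
  by rewrite -(eq_map add1n) (iotaDl 1 1) perm_map.
case: w hw pat_w {szw} => [|x w] hw /=; first by have := perm_size hw.
move=> <-; have : x \in x :: w by rewrite inE eqxx.
rewrite (perm_mem hw) mem_iota => /andP[x_gt0 _].
by congr (_ :: _); elim: w x {hw x_gt0} => [|y w IHw] x //=; rewrite IHw.
Qed.

(** Inverse of [runs], given the first letter [b] and positive run lengths. *)
Fixpoint expand (b : bool) (rs : seq nat) : bitseq :=
  if rs is r :: rs' then nseq r b ++ expand (~~ b) rs' else [::].

Lemma head_expand b rs : all (leq 1) rs -> head b (expand b rs) = b.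
Proof. by case: rs => [|[|r] rs]. Qed.

Lemma runs_expand b rs : all (leq 1) rs -> runs (expand b rs) = rs.
Proof.
elim: rs b => [|[|r] rs IHrs] b //= rs_gt0.
elim: r => [|r IHr] /=; last by rewrite eqxx IHr.
by rewrite head_expand //; case: eqP => [|_]; [case: (b) | rewrite IHrs].
Qed.

Lemma runs_gt0 s : all (leq 1) (runs s).
Proof.
elim: s => [|b [|c s] IHs] //; first by case: b.
rewrite runs_cons; case: ifP => _; last by rewrite /= IHs.
by case: (runs _) IHs => [|r rs] //= /andP[].
Qed.

Lemma expand_runs b s : expand b (runs (b :: s)) = b :: s.
Proof.
elim: s b => [|c s IHs] b; first by case: b.
rewrite runs_cons; case: eqP => [->|neq_bc].
  have := runs_head_gt0 c s; rewrite -[RHS]/(c :: (c :: s)) -[in RHS]IHs.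
  by case: (runs (c :: s)).
by have -> : c = ~~ b; [case: b c neq_bc {IHs} => [] [] | rewrite /= IHs].
Qed.

Lemma count_nseq_cat (b c : bool) r s :
  count (pred1 b) (nseq r c ++ s) = r * (c == b) + count (pred1 b) s.
Proof. by rewrite count_cat count_nseq mulnC. Qed.

Lemma count_expand_ge b rs : all (leq 1) rs ->
  uphalf (size rs) <= count (pred1 b) (expand b rs) /\
  (size rs)./2 <= count (pred1 (~~ b)) (expand b rs).
Proof.
elim: rs b => [|r rs IHrs] b //= /andP[r_gt0 /(IHrs (~~ b))].
rewrite negbK !count_nseq_cat eqxx.
have -> : (b == ~~ b) = false by case: b.
lia.
Qed.

Lemma count_expand_nseq b j :
  count (pred1 b) (expand b (nseq j 1)) = uphalf j /\
  count (pred1 (~~ b)) (expand b (nseq j 1)) = j./2.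
Proof.
elim: j b => [|j IHj] b //=; have [] := IHj (~~ b); rewrite negbK => -> ->.
by rewrite eqxx; case: b.
Qed.

Lemma hook_type_eq r t1 t2 t1' t2' : (0 < r -> t1 = t1') -> (1 < r -> t2 = t2') ->
  hook_type r t1 t2 = hook_type r t1' t2'.
Proof.
move=> e1 e2; apply/eq_in_map => i; rewrite mem_iota add0n /=.
by case: i => [|[|i]].
Qed.

Lemma hook_typeSS r t1 t2 : hook_type r.+2 t1 t2 = [:: t1, t2 & nseq r 2].
Proof.
have twos k : map (nth 2 [:: t1; t2]) (iota k.+2 r) = nseq r 2.
  by elim: r k => [|r IHr] k //=; rewrite IHr nth_nil.
by rewrite /hook_type /mkseq /= twos.
Qed.

(** The number of runs and of each letter are kept, all runs after the first two get length 1, and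
    the first two absorb the excess of either letter. *)
Lemma hook_pattern b s : let s0 := b :: s in
  let r := size (runs s0) in
  let c1 := count (pred1 b) s0 in let c2 := count (pred1 (~~ b)) s0 in
  [/\ uphalf r <= c1, r./2 <= c2 &
  exists s', [/\ map S (runs (b :: s')) = hook_type r (c1.+2 - uphalf r) (c2.+2 - r./2),
    count (pred1 b) (b :: s') = c1 & count (pred1 (~~ b)) (b :: s') = c2]].
Proof.
move=> s0 r c1 c2.
have [] := count_expand_ge b (runs_gt0 s0); rewrite expand_runs -/r -/c1 -/c2 => ge1 ge2.
split=> //; have := runs_head_gt0 b s; rewrite -/s0.
have := expand_runs b s; rewrite -/s0.
case def_r : (runs s0) => [|x [|y rs]] //.
  (* A pattern with a single run is already hook-shaped. *)
  rewrite [expand _ _]/= cats0 => def_s x_gt0; exists s; rewrite -/s0 def_r; split=> //.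
  rewrite /r def_r /c1 -def_s count_nseq /= eqxx mul1n /hook_type /mkseq /=.
  by congr [:: _]; lia.
(* Beyond the first two runs, [uphalf r - 1] runs of length 1 carry [b] and [r./2 - 1] carry the
   other letter. *)
move=> _ _; pose a1 := c1.+1 - uphalf r; pose a2 := c2.+1 - r./2.
have r_ge2 : 1 < r by rewrite /r def_r.
have def_rr : r = r.-2.+2 by case: (r) r_ge2 => [|[]].
have a_gt0 : all (leq 1) [:: a1, a2 & nseq r.-2 1].
  by rewrite /= all_nseq orbT andbT /a1 /a2; lia.
exists (behead (expand b [:: a1, a2 & nseq r.-2 1])).
have -> : b :: behead (expand b [:: a1, a2 & nseq r.-2 1]) =
          expand b [:: a1, a2 & nseq r.-2 1].
  by have := a_gt0; rewrite /=; case: (a1).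
rewrite runs_expand // [in hook_type _]def_rr hook_typeSS.
have [h1 h2] := count_expand_nseq b r.-2.
split.
- by rewrite /= map_nseq /a1 /a2; congr [:: _, _ & _]; lia.
- rewrite [expand _ _]/= negbK !count_nseq_cat h1 eqxx.
  have -> : (~~ b == b) = false by case: (b).
  by rewrite /a1; lia.
- rewrite [expand _ _]/= negbK !count_nseq_cat h2 eqxx.
  have -> : (b == ~~ b) = false by case: (b).
  by rewrite /a2; lia.
Qed.

(** The leading 0 prolongs an initial run of U, and adds a run before an initial D. *)
Lemma stat_pattern w b s : uniq (0 :: w) -> pattern w = b :: s ->
  stat w = (size (runs (b :: s)) + b, ud (b :: s), count id (b :: s)).
Proof.
case: w => [|x w] // Uw /= pat_w; rewrite statE //= pat_w add0n addKn size_runs /=.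
by congr (_, _, _); lia.
Qed.

Lemma hook_permutation n pi : 1 < n -> pi \in L (iota 1 n) ->
  let b := chi_plus pi == 1 in let r := size (type pi) in let d := des pi in
  let c1 := if b then d else n.-1 - d in let c2 := if b then n.-1 - d else d in
  [/\ uphalf r <= c1, r./2 <= c2, d < n &
  exists pi', [/\ pi' \in L (iota 1 n), chi_plus pi' = chi_plus pi, stat pi' = stat pi &
    type pi' = hook_type r (c1.+2 - uphalf r) (c2.+2 - r./2)]].
Proof.
move=> n_gt1 hpi; have szpi : size pi = n by rewrite (perm_size hpi) size_iota.
have /andP[_ Upi] := L_uniq hpi.
rewrite typeE ?szpi // size_map des_pattern.
have [x [y [w def_pi]]] : exists x y w, pi = [:: x, y & w].
  by case: (pi) szpi n_gt1 => [|x [|y w]] /= <- // _; exists x, y, w.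
have pat_pi : pattern pi = (y < x) :: pairmap gtn y w by rewrite def_pi.
have sz_pat : size (pairmap gtn y w) = n.-2 by rewrite size_pairmap -szpi def_pi.
have chi_pi : chi_plus pi = (y < x) by rewrite def_pi.
rewrite chi_pi eqb1 pat_pi; set b := y < x; set s := pairmap gtn y w in sz_pat *.
have := hook_pattern b s; cbv zeta => -[ge1 ge2 [s' [runs_s' cnt1 cnt2]]].
have cntE (t : bitseq) : count (pred1 b) t = (if b then count id t else size t - count id t) /\
    count (pred1 (~~ b)) t = (if b then size t - count id t else count id t).
  have cntT : count (pred1 true) t = count id t by apply: eq_count => -[].
  have cntF : count (pred1 false) t = size t - count id t.
    by rewrite -(count_predC (pred1 false)) (@eq_count _ (predC _) id) ?addnK // => -[].
  by case: (b).
have sz_s : size (b :: s) = n.-1 by rewrite /= sz_pat; lia.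
have [c1E c2E] := cntE (b :: s); rewrite sz_s in c1E c2E.
rewrite -c1E -c2E; have le_d := count_size id (b :: s).
split=> //; first by rewrite sz_s in le_d; lia.
have [c1E' c2E'] := cntE (b :: s'); have le_d' := count_size id (b :: s').
have sz_s' : size (b :: s') = n.-1.
  by rewrite -sz_s in c1E c2E *; case: (b) c1E c2E c1E' c2E' cnt1 cnt2 le_d le_d'; lia.
have cnt_s' : count id (b :: s') = count id (b :: s).
  by case: (b) c1E c2E c1E' c2E' cnt1 cnt2; lia.
have [pi' hpi' pat_pi'] := pattern_realizable (b :: s').
rewrite sz_s' prednK in hpi'; last by lia.
exists pi'; split=> //.
- have szpi' : size pi' = n by rewrite (perm_size hpi') size_iota.
  by case: (pi') pat_pi' => [|x' [|y' w']] //= [-> _].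
- have size_eq : size (runs (b :: s')) = size (runs (b :: s)).
    by rewrite -(size_map S) runs_s' size_mkseq.
  rewrite (stat_pattern (L_uniq hpi') pat_pi') (stat_pattern (L_uniq hpi) pat_pi).
  rewrite size_eq cnt_s'; congr (_, _, _).
  (* With equal first letters, the number of runs determines the number of UD by parity. *)
  move: size_eq; rewrite !size_runs; move: (ud _) (ud _) => u v.
  by case: (last b s); case: (last b s'); rewrite /=; lia.
- have /andP[_ Upi'] := L_uniq hpi'.
  by rewrite typeE ?(perm_size hpi') ?size_iota // pat_pi'.
Qed.

Theorem theorem1 (m n k d : nat) (pi sigma : seq nat)
  (hm : 1 <= m) (hn : 1 <= n)
  (hpi : pi \in L (iota 1 n)) (hpk : pk pi = k) (hdes : des pi = d)
  (hsigma : sigma \in L (iota n.+1 m)) :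
  [/\ (size (type pi) = 2 * k -> chi_plus pi = 0 -> pi \notin Pi1 n k d ->
        exists pi' : seq nat, [/\ pi' \in Pi1 n k d, stat pi = stat pi' &
          perm_eq (statS pi sigma) (statS pi' sigma)]),
      (size (type pi) = 2 * k + 1 -> chi_plus pi = 0 -> pi \notin Pi2 n k d ->
        exists pi' : seq nat, [/\ pi' \in Pi2 n k d, stat pi = stat pi' &
          perm_eq (statS pi sigma) (statS pi' sigma)]),
      (size (type pi) = 2 * k + 1 -> chi_plus pi = 1 -> pi \notin Pi3 n k d ->
        exists pi' : seq nat, [/\ pi' \in Pi3 n k d, stat pi = stat pi' &
          perm_eq (statS pi sigma) (statS pi' sigma)]) &
      (size (type pi) = 2 * k + 2 -> chi_plus pi = 1 -> pi \notin Pi4 n k d ->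
        exists pi' : seq nat, [/\ pi' \in Pi4 n k d, stat pi = stat pi' &
          perm_eq (statS pi sigma) (statS pi' sigma)])].
Proof.
(* For [n = 1] the type is (1): only the second case can occur, and [pi] then lies in [Pi2]
   itself. *)
have [n_gt1|n_le1] := ltnP 1 n; last first.
  have n1 : n = 1 by lia.
  have def_pi : pi = [:: 1].
    by move: hpi; rewrite n1 /L inE => /perm_small_eq -> .
  have -> : size (type pi) = 1 by rewrite def_pi.
  split; try by rewrite def_pi.
  - by lia.
  - move=> _ _ /negP[]; apply/and3P; split=> //; rewrite def_pi //.
    by rewrite -hpk -hdes n1 def_pi.
have [ge1 ge2 d_lt [pi' [hpi' chi' stat' type']]] := hook_permutation n_gt1 hpi.
have compat := statS_compat hsigma hpi hpi' hn (esym stat').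
rewrite hdes in ge1 ge2 d_lt type'.
(* In the four cases, [uphalf r] is k, k+1, k+1, k+1 and [r./2] is k, k, k, k+1, with r the number
   of biruns. *)
split=> size_type chi _; exists pi'; split=> //; apply/and3P; split=> //;
  rewrite ?chi' ?chi // type' ?chi ?size_type; apply/eqP;
  rewrite chi size_type /= in ge1 ge2 *;
  apply: hook_type_eq; lia.
Qed.
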